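(* Let $n,k\ge0$ and let $\lambda/\mu$ be a horizontal strip with $\lambda\vdash n$. Then $\mathcal{E}_{\lambda/\mu}(k)$ is a polynomial in $q$ with nonnegative integer coefficients.
   Context: Partitions are drawn as Young diagrams in English notation; the cell in row $i$, column $j$ has content $j-i$. For partitions $\mu\subseteq\lambda$ the skew diagram $\lambda/\mu$ consists of the cells of $\lambda$ not in $\mu$; it is a horizontal strip if no two of its cells lie in the same column. For integers $a$ let $[a]_q=(1-q^a)/(1-q)$. Let $\lambda\vdash n$, $\mu\vdash j$. Let $\mathfrak{t}^{\lambda/\mu}$ be the filling of the cells of $\lambda/\mu$ with $j+1,\dots,n$ in order, rows from top to bottom and within each row left to right; for $j<\ell\le n$ let $c_\ell$ be the content of the cell containing $\ell$. With $q$ an indeterminate, define $$\mathcal{E}_{\lambda/\mu}(k)=q^{nk-\binom k2}\sum_{j<\ell_1<\cdots<\ell_k\le n}\ \prod_{m=1}^k q^{-\ell_m}\,[\ell_m+1-m+c_{\ell_m}]_q .$$ *)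

(* Defs.v *)
From HB Require Import structures.
From mathcomp Require Import all_boot all_order all_algebra.

Set Implicit Arguments.
Unset Strict Implicit.
Unset Printing Implicit Defensive.

Import Order.TTheory GRing.Theory Num.Theory.
Local Open Scope ring_scope.

(* Partitions are weakly decreasing sequences of positive parts. *)
Definition is_partition (n : nat) (la : seq nat) : bool :=
  [&& sorted geq la, 0%N \notin la & sumn la == n].

(* Cells are pairs (row, column), both counted from 0, which leaves the content
   column - row unchanged; they are listed row by row from top to bottom, and
   from left to right within each row. *)
Definition diagram (la : seq nat) : seq (nat * nat) :=
  [seq (i, c) | i <- iota 0 (size la), c <- iota 0 (nth 0%N la i)].

Definition skew_diagram (la mu : seq nat) : seq (nat * nat) :=
  [seq x <- diagram la | x \notin diagram mu].

Definition content (x : nat * nat) : int := x.2%:Z - x.1%:Z.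

Definition horizontal_strip (la mu : seq nat) : Prop :=
  {subset diagram mu <= diagram la} /\
  {in skew_diagram la mu &, forall x y, x.2 = y.2 -> x = y}.

(* The cell containing l in the row-reading filling of la/mu by j+1, ..., n,
   where j = |mu|; meaningful only for j < l <= n. *)
Definition cell_of_entry (la mu : seq nat) (l : nat) : nat * nat :=
  nth (0%N, 0%N) (skew_diagram la mu) (l - (sumn mu).+1).

Definition entry_content (la mu : seq nat) (l : nat) : int :=
  content (cell_of_entry la mu l).

(* Negative powers of the indeterminate q occur, so we work in Frac(Z[q]). *)
Definition Zq : fieldType := {fraction {poly int}}.

Definition q : Zq := tofrac 'X.

Definition qint (a : int) : Zq := (1 - q ^ a) / (1 - q).

(* The index m of the tuple l starts from 0, hence the m.+1. *)
Definition Ecal (n j : nat) (la mu : seq nat) (k : nat) : Zq :=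
  q ^ ((n * k)%:Z - 'C(k, 2)%:Z) *
  \sum_(l : k.-tuple 'I_n.+1 |
          sorted ltn (map val l) && all (fun i : 'I_n.+1 => (j < i)%N) l)
    \prod_(m < k)
      (q ^ (- (tnth l m)%:Z) *
       qint ((tnth l m)%:Z + 1 - m.+1%:Z + entry_content la mu (tnth l m))).

(* Main.v *)
Require Import Defs.
From mathcomp Require Import all_boot all_order all_algebra.
From mathcomp Require Import zify.
Import Order.TTheory GRing.Theory Num.Theory.
Local Open Scope ring_scope.

(** Every summand is already a product of powers of [q] and of q-integers of
    natural numbers.  The tuple is strictly increasing in [(j, n]], so its entry
    of index [m] (from 0) lies between [j + m + 1] and [n - (k - 1 - m)].  The
    upper bounds add up to [n k - 'C(k, 2)], which absorbs the negative powers
    of [q].  For the q-integers, the content of a cell of the strip is at least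
    minus its row index, and that index is at most the number of rows of [mu],
    hence at most [j]: otherwise the cell right above would lie in the strip
    too. *)

(** A predicate on the fraction field closed under sums and products, so that each factor of [Ecal]
    can be treated separately. *)
Definition nneg_poly (x : Zq) : Prop :=
  exists p : {poly int}, (forall i : nat, 0 <= p`_i) /\ x = tofrac p.

Lemma nneg_poly0 : nneg_poly 0.
Proof. by exists 0; rewrite tofrac0; split=> // i; rewrite coef0. Qed.

Lemma nneg_poly1 : nneg_poly 1.
Proof. by exists 1; rewrite tofrac1; split=> // i; rewrite coef1 ler0n. Qed.

Lemma nneg_polyD (x y : Zq) : nneg_poly x -> nneg_poly y -> nneg_poly (x + y).
Proof.
move=> [p [p_ge0 ->]] [r [r_ge0 ->]]; exists (p + r); rewrite tofracD.
by split=> // i; rewrite coefD addr_ge0.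
Qed.

Lemma nneg_polyM (x y : Zq) : nneg_poly x -> nneg_poly y -> nneg_poly (x * y).
Proof.
move=> [p [p_ge0 ->]] [r [r_ge0 ->]]; exists (p * r); rewrite tofracM.
by split=> // i; rewrite coefM sumr_ge0 // => m _; rewrite mulr_ge0.
Qed.

Lemma nneg_poly_qX (a : nat) : nneg_poly (q ^+ a).
Proof.
by exists 'X^a; rewrite tofracXn; split=> // i; rewrite coefXn ler0n.
Qed.

Lemma q_neq0 : q != 0.
Proof. by rewrite /q tofrac_eq0 polyX_eq0. Qed.

Lemma subr1q_neq0 : 1 - q != 0.
Proof.
rewrite /q -tofrac1 -tofracB tofrac_eq0 -oppr_eq0 opprB.
by rewrite polyXsubC_eq0.
Qed.

(** The quotient is the geometric sum of the [q ^+ i] with [i < a]. *)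
Lemma nneg_poly_qint (a : nat) : nneg_poly (qint a%:Z).
Proof.
rewrite /qint -exprnP -opprB subrX1 -mulNr opprB mulrC mulKf ?subr1q_neq0 //.
apply: big_ind; [exact: nneg_poly0 | exact: nneg_polyD |].
by move=> i _; apply: nneg_poly_qX.
Qed.

Lemma mem_diagram (la : seq nat) (x : nat * nat) :
  (x \in diagram la) = (x.2 < nth 0%N la x.1)%N.
Proof.
case: x => i c /=; apply/allpairsPdep/idP => [[i' [c' [_ +]]]|lt_c].
  by rewrite mem_iota => lt_c' [-> ->].
exists i, c; rewrite !mem_iota !add0n /=; split=> //; rewrite ltnNge.
by apply: contraTN lt_c => le_i; rewrite nth_default.
Qed.

Lemma leq_size_sumn (s : seq nat) : 0%N \notin s -> (size s <= sumn s)%N.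
Proof.
elim: s => //= a s IHs; rewrite inE negb_or eq_sym -lt0n => /andP[a_gt0 /IHs].
by move: a_gt0; lia.
Qed.

Lemma skew_diagram_row_le (la mu : seq nat) (x : nat * nat) :
  sorted geq la -> horizontal_strip la mu -> x \in skew_diagram la mu ->
  (x.1 <= size mu)%N.
Proof.
case: x => -[|i] c //= sorted_la [_ strip] xS; rewrite ltnNge.
apply/negP => le_mu; move: (xS); rewrite mem_filter !mem_diagram /= => /andP[_].
case: (ltnP i.+1 (size la)) => [lt_i lt_c|le_i]; last by rewrite nth_default.
have geq_trans : transitive geq by move=> b a d /= ba db; apply: leq_trans db ba.
have le_rows : (nth 0 la i.+1 <= nth 0 la i)%N.
  by apply: (sorted_ltn_nth geq_trans 0%N sorted_la); rewrite ?inE // ltnW.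
(* Here [size mu <= i], so row [i] of [mu] has the default length 0 and cannot contain the cell
   above. *)
have yS : (i, c) \in skew_diagram la mu.
  rewrite mem_filter !mem_diagram /= nth_default //.
  exact: leq_trans lt_c le_rows.
by have [] := strip _ _ xS yS erefl; lia.
Qed.

Lemma entry_content_ge (n j : nat) (la mu : seq nat) (l : nat) :
  is_partition n la -> is_partition j mu -> horizontal_strip la mu ->
  - j%:Z <= entry_content la mu l.
Proof.
move=> /and3P[sorted_la _ _] /and3P[_ mu_pos /eqP sum_mu] strip.
rewrite /entry_content /cell_of_entry /content.
set S := skew_diagram la mu; set i := (l - _)%N.
(* Past the end of the list the default cell [(0, 0)] has content 0, which satisfies the bound as
   well. *)
have [lt_i|le_i] := ltnP i (size S); last by rewrite nth_default //=; lia.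
have /(skew_diagram_row_le _ _ _ sorted_la strip) : nth (0%N, 0%N) S i \in S.
  exact: mem_nth.
by have := leq_size_sumn _ mu_pos; lia.
Qed.

Lemma sorted_ltn_nth_bounds (a b : nat) (s : seq nat) (m : nat) :
  sorted ltn s -> all (fun i => a < i <= b)%N s -> (m < size s)%N ->
  (a + m < nth 0 s m)%N /\ (nth 0 s m + (size s - m.+1) <= b)%N.
Proof.
elim: s a m => //= x s IHs a m path_s /andP[/andP[lt_ax le_xb] all_s] lt_m.
(* The induction replaces the lower bound [a] by the head [x]. *)
have all_x : all (fun i => x < i <= b)%N s.
  apply/allP => y ys; move: (allP all_s _ ys) => /andP[_ ->]; rewrite andbT.
  exact: (allP (order_path_min ltn_trans path_s)).
have {IHs} bounds m0 := IHs x m0 (path_sorted path_s) all_x.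
case: m lt_m => [_|m lt_m] /=; last first.
  by have [] := bounds m lt_m; lia.
(* For the head itself, the upper bound comes from the first entry of the tail, if there is one. *)
have [s0|] := posnP (size s); first by rewrite s0; lia.
by move=> /bounds[]; lia.
Qed.

Lemma sum_subn_bin2 (n k : nat) :
  \sum_(m < k) (n%:Z - (k - m.+1)%N%:Z) = (n * k)%:Z - 'C(k, 2)%:Z.
Proof.
rewrite sumrB sumr_const card_ord -bin2_sum big_mkord.
(* Under the reversal of [m], the subtracted terms become 0, ..., k - 1. *)
rewrite (reindex_inj rev_ord_inj) /= -natz -mulrnA natz; congr (_ - _).
rewrite -[RHS]natz natr_sum; apply: eq_bigr => i _; rewrite natz.
by have := ltn_ord i; lia.
Qed.

Lemma qX_sum (I : finType) (F : I -> int) :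
  q ^ (\sum_i F i) = \prod_i q ^ F i.
Proof.
apply: (big_morph (fun a : int => q ^ a)) => [a b|]; last exact: expr0z.
exact: expfzDr q_neq0.
Qed.

Theorem theorem5p12 (n j k : nat) (la mu : seq nat)
  (hla : is_partition n la) (hmu : is_partition j mu)
  (hstrip : horizontal_strip la mu) :
  exists p : {poly int},
    (forall i : nat, 0 <= p`_i) /\ Ecal n j la mu k = tofrac p.
Proof.
suff: nneg_poly (Ecal n j la mu k) by [].
rewrite /Ecal mulr_sumr.
apply: big_ind; [exact: nneg_poly0 | exact: nneg_polyD |].
move=> l /andP[sorted_l all_l].
(* The prefactor is shared out: the factor of index [m] receives [q] to the upper bound of its
   entry. *)
rewrite -sum_subn_bin2 qX_sum -big_split /=.
apply: big_ind; [exact: nneg_poly1 | exact: nneg_polyM |].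
move=> m _; rewrite mulrA -expfzDr ?q_neq0 //.
have [] : (j + m < tnth l m)%N /\ (tnth l m + (k - m.+1) <= n)%N.
  have -> : tnth l m = nth 0%N (map val l) m :> nat.
    by rewrite (tnth_nth ord0) (nth_map ord0) ?size_tuple.
  have size_l : size (map val l) = k by rewrite size_map size_tuple.
  have := sorted_ltn_nth_bounds j n (map val l) m sorted_l.
  rewrite size_l; apply=> //.
  by rewrite all_map; apply: sub_all all_l => i /= ->; rewrite -ltnS ltn_ord.
have := entry_content_ge _ _ _ _ (tnth l m) hla hmu hstrip.
move: (nat_of_ord (tnth l m)) (entry_content _ _ _) => i c ge_c gt_i le_i.
have -> : n%:Z - (k - m.+1)%N%:Z - i%:Z = (n - (k - m.+1) - i)%N%:Z by lia.
(* Since [i >= j + m + 1] and [c >= - j], this argument is even at least 1. *)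
have /gez0_abs <- : 0 <= i%:Z + 1 - m.+1%:Z + c by lia.
exact: nneg_polyM (nneg_poly_qX _) (nneg_poly_qint _).
Qed.
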